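(* Let $B=B_0\oplus B_1$ be a Bol superalgebra over $\mathbb{K}$, let $r,s\in\mathbb{Z}_2$, and let $(P,a)\in PS_r(B)$, $(Q,b)\in PS_r(B)$, $(R,c)\in PS_s(B)$ and $\lambda\in\mathbb{K}$. Then (1) $(P,a)+\lambda(Q,b):=(P+\lambda Q,\ a+\lambda b)\in PS_r(B)$; (2) $[(P,a),(R,c)]:=\big([P,R],\ P(c)-(-1)^{rs}R(a)-a\cdot c\big)\in PS_{r+s}(B)$, where $[P,R]=PR-(-1)^{rs}RP$.
   Context: All vector superspaces and superalgebras are finite dimensional over a fixed field $\mathbb{K}$ of characteristic $0$; $\bar x\in\mathbb{Z}_2$ denotes the parity of a homogeneous element $x$. A Bol superalgebra is a superspace $B=B_0\oplus B_1$ with a bilinear operation $(x,y)\mapsto x\cdot y=xy$, $B_i\cdot B_j\subseteq B_{i+j}$, and a trilinear operation $[\,,\,,\,]$, $[B_i,B_j,B_k]\subseteq B_{i+j+k}$, such that for all homogeneous $x,y,z,u,v,w$: (BS1) $x\cdot y=-(-1)^{\bar x\bar y}y\cdot x$; (BS2) $[x,y,z]=-(-1)^{\bar x\bar y}[y,x,z]$; (BS3) $[x,y,z]+(-1)^{\bar x(\bar y+\bar z)}[y,z,x]+(-1)^{\bar z(\bar x+\bar y)}[z,x,y]=0$; (BS4) $[x,y,[u,v,w]]=[[x,y,u],v,w]+(-1)^{\bar u(\bar x+\bar y)}[u,[x,y,v],w]+(-1)^{(\bar x+\bar y)(\bar u+\bar v)}[u,v,[x,y,w]]$; (BS5) $[x,y,u\cdot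 v]=(-1)^{\bar u(\bar x+\bar y)}u\cdot[x,y,v]+[x,y,u]\cdot v+(-1)^{(\bar x+\bar y)(\bar u+\bar v)}[u,v,x\cdot y]+(x\cdot y)\cdot(u\cdot v)$. A linear map $P:B\to B$ of degree $r\in\mathbb{Z}_2$ (i.e. $P(B_i)\subseteq B_{i+r}$) is a pseudo superderivation with companion $a\in B_r$ if for all $x,y,z\in B_0\cup B_1$: $P([x,y,z])=[P(x),y,z]+(-1)^{r\bar x}[x,P(y),z]+(-1)^{r(\bar x+\bar y)}[x,y,P(z)]$ and $P(xy)=(-1)^{r\bar x}xP(y)+P(x)y+(-1)^{r(\bar x+\bar y)}[x,y,a]+a\cdot xy$. $\mathrm{Com}(P)$ is the set of all companions of $P$, $pS_r(B)$ is the set of all pseudo superderivations of degree $r$, and $PS_r(B)=\{(P,a):P\in pS_r(B),\ a\in\mathrm{Com}(P)\}$. *)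

(* Defs.v *)
From HB Require Import structures.
From mathcomp Require Import all_boot all_order all_algebra.

Set Implicit Arguments.
Unset Strict Implicit.
Unset Printing Implicit Defensive.

Import GRing.Theory.
Local Open Scope ring_scope.

(* (-1)^i for a residue i mod 2; the exponent is the representative 0 or 1. *)
Definition zsign (K : fieldType) (i : 'Z_2) : K := (-1) ^+ (i : nat).
Arguments zsign {K} i.

(* The axioms quantify over parities i, j, ... and elements of the matching
   homogeneous parts, so the zero vector counts as homogeneous of either
   parity. *)
Record bolSuperalgebra (K : fieldType) := BolSuperalgebra {
  bol_sort :> vectType K;
  hpart : 'Z_2 -> {vspace bol_sort};
  bmul : bol_sort -> bol_sort -> bol_sort;
  btri : bol_sort -> bol_sort -> bol_sort -> bol_sort;
  hpart_full : (hpart 0%R + hpart 1%R)%VS = fullv;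
  hpart_direct : directv (hpart 0%R + hpart 1%R);
  bmul_linearl : forall y, linear (fun x => bmul x y);
  bmul_linearr : forall x, linear (fun y => bmul x y);
  btri_linear1 : forall y z, linear (fun x => btri x y z);
  btri_linear2 : forall x z, linear (fun y => btri x y z);
  btri_linear3 : forall x y, linear (fun z => btri x y z);
  bmul_hpart : forall i j x y, x \in hpart i -> y \in hpart j ->
    bmul x y \in hpart (i + j);
  btri_hpart : forall i j k x y z,
    x \in hpart i -> y \in hpart j -> z \in hpart k ->
    btri x y z \in hpart (i + j + k);
  bol_BS1 : forall i j x y, x \in hpart i -> y \in hpart j ->
    bmul x y = - (zsign (i * j) *: bmul y x);
  bol_BS2 : forall i j k x y z,
    x \in hpart i -> y \in hpart j -> z \in hpart k ->
    btri x y z = - (zsign (i * j) *: btri y x z);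
  bol_BS3 : forall i j k x y z,
    x \in hpart i -> y \in hpart j -> z \in hpart k ->
    btri x y z + zsign (i * (j + k)) *: btri y z x
               + zsign (k * (i + j)) *: btri z x y = 0;
  bol_BS4 : forall i j k l m x y u v w,
    x \in hpart i -> y \in hpart j ->
    u \in hpart k -> v \in hpart l -> w \in hpart m ->
    btri x y (btri u v w) =
      btri (btri x y u) v w
      + zsign (k * (i + j)) *: btri u (btri x y v) w
      + zsign ((i + j) * (k + l)) *: btri u v (btri x y w);
  bol_BS5 : forall i j k l x y u v,
    x \in hpart i -> y \in hpart j -> u \in hpart k -> v \in hpart l ->
    btri x y (bmul u v) =
      zsign (k * (i + j)) *: bmul u (btri x y v)
      + bmul (btri x y u) v
      + zsign ((i + j) * (k + l)) *: btri u v (bmul x y)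
      + bmul (bmul x y) (bmul u v)
}.

Section PseudoSuperderivations.
Variables (K : fieldType) (B : bolSuperalgebra K).

Definition has_degree (r : 'Z_2) (P : 'End(B)) : Prop :=
  forall i : 'Z_2, (P @: hpart B i <= hpart B (i + r)%R)%VS.

Definition pseudo_superder_with (r : 'Z_2) (P : 'End(B)) (a : B) : Prop :=
  [/\ has_degree r P,
      a \in hpart B r,
      forall i j k x y z,
        x \in hpart B i -> y \in hpart B j -> z \in hpart B k ->
        P (btri x y z) =
          btri (P x) y z
          + zsign (r * i) *: btri x (P y) z
          + zsign (r * (i + j)) *: btri x y (P z)
    & forall i j x y, x \in hpart B i -> y \in hpart B j ->
        P (bmul x y) =
          zsign (r * i) *: bmul x (P y)
          + bmul (P x) y
          + zsign (r * (i + j)) *: btri x y a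
          + bmul a (bmul x y)].

(* The degree r is kept as a parameter of Com because it is not always
   determined by P: the zero map has both degrees. *)
Definition Com (r : 'Z_2) (P : 'End(B)) (a : B) : Prop :=
  pseudo_superder_with r P a.

Definition pS (r : 'Z_2) (P : 'End(B)) : Prop :=
  exists a : B, pseudo_superder_with r P a.

Definition PS (r : 'Z_2) (Pa : 'End(B) * B) : Prop :=
  pS r Pa.1 /\ Com r Pa.1 Pa.2.

Definition supercomm (r s : 'Z_2) (P R : 'End(B)) : 'End(B) :=
  (P \o R)%VF - zsign (r * s) *: (R \o P)%VF.

End PseudoSuperderivations.

(* Main.v *)
Require Import Defs.
From HB Require Import structures.
From mathcomp Require Import all_boot all_order all_algebra.
From mathcomp Require Import ring.

Set Implicit Arguments.
Unset Strict Implicit.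
Unset Printing Implicit Defensive.

Import GRing.Theory.
Local Open Scope ring_scope.

(** The set of pairs (P, a) is a superspace because every defining condition is
linear in (P, a).  For the bracket, expanding P (R (x y)) and R (P (x y)), the
terms in which P and R hit different arguments cancel, as for ordinary
superderivations, and so do a (c (xy)) and c (a (xy)).  Up to Koszul signs, the
remaining terms not of the form required by the companion P c - R a - a c are
- a [x,y,c] - [a,xy,c] + c [x,y,a] + [c,xy,a], and
[tri_companion_product] says that they add up to - [x,y,ac] - (ac)(xy).  That
identity is axiom BS5 for the pair (x, y) acting on a c, where BS3 turns the
term [a,c,xy] into [a,xy,c] - [c,xy,a].

Identities between vectors are checked by applying an arbitrary linear form:
they become polynomial identities over the ground field, in which every sign is
a product of the values 1 or -1 of [zsign] on products of two parities. *)

Lemma zsignD (K : fieldType) (i j : 'Z_2) :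
  zsign (i + j) = zsign i * zsign j :> K.
Proof. by rewrite /zsign -exprD /= modn2 signr_odd. Qed.

Lemma zsign_pm1 (K : fieldType) (i : 'Z_2) :
  zsign i = 1 :> K \/ zsign i = -1 :> K.
Proof.
by rewrite /zsign -signr_odd; case: (odd i); [right|left]; rewrite ?expr1.
Qed.

(** Linear forms separate the vectors of a finite-dimensional space. *)
Lemma eq_scalar_forms (K : fieldType) (V : vectType K) (u v : V) :
  (forall f : {scalar V}, f u = f v) -> u = v.
Proof.
move=> eq_uv; rewrite (coord_vbasis (memvf u)) (coord_vbasis (memvf v)).
by apply: eq_bigr => i _; rewrite (eq_uv (coord (vbasis fullv) i)).
Qed.

(* Proves an identity between linear combinations of vectors whose coefficients
   are signs: splits the signs on sums of parities, applies a linear form, and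
   evaluates each remaining sign as 1 or -1. *)
Ltac sign_module :=
  apply: eq_scalar_forms => f;
  rewrite ?(mulrDr, mulrDl, zsignD);
  rewrite ?(linearD, linearN, linearZ) /=;
  repeat match goal with
  | |- context [@zsign ?F ?i] =>
      let e := fresh "e" in
      case: (zsign_pm1 F i) => e; rewrite !e; clear e
  end; ring.

Section Multilinearity.
Variables (K : fieldType) (B : bolSuperalgebra K).
Implicit Types (k : K) (x y z : B).

Lemma bmulDl x x' y : bmul (x + x') y = bmul x y + bmul x' y.
Proof. by have := bmul_linearl y 1 x x'; rewrite !scale1r. Qed.

Lemma bmulDr x y y' : bmul x (y + y') = bmul x y + bmul x y'.
Proof. by have := bmul_linearr x 1 y y'; rewrite !scale1r. Qed.

Lemma btriD1 x x' y z : btri (x + x') y z = btri x y z + btri x' y z.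
Proof. by have := btri_linear1 y z 1 x x'; rewrite !scale1r. Qed.

Lemma btriD2 x y y' z : btri x (y + y') z = btri x y z + btri x y' z.
Proof. by have := btri_linear2 x z 1 y y'; rewrite !scale1r. Qed.

Lemma btriD3 x y z z' : btri x y (z + z') = btri x y z + btri x y z'.
Proof. by have := btri_linear3 x y 1 z z'; rewrite !scale1r. Qed.

Lemma bmul0l y : bmul (0 : B) y = 0.
Proof. by apply: (addrI (bmul 0 y)); rewrite -bmulDl !addr0. Qed.

Lemma bmul0r x : bmul x (0 : B) = 0.
Proof. by apply: (addrI (bmul x 0)); rewrite -bmulDr !addr0. Qed.

Lemma btri01 y z : btri (0 : B) y z = 0.
Proof. by apply: (addrI (btri 0 y z)); rewrite -btriD1 !addr0. Qed.

Lemma btri02 x z : btri x (0 : B) z = 0.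
Proof. by apply: (addrI (btri x 0 z)); rewrite -btriD2 !addr0. Qed.

Lemma btri03 x y : btri x y (0 : B) = 0.
Proof. by apply: (addrI (btri x y 0)); rewrite -btriD3 !addr0. Qed.

Lemma bmulZl k x y : bmul (k *: x) y = k *: bmul x y.
Proof. by have := bmul_linearl y k x 0; rewrite bmul0l !addr0. Qed.

Lemma bmulZr k x y : bmul x (k *: y) = k *: bmul x y.
Proof. by have := bmul_linearr x k y 0; rewrite bmul0r !addr0. Qed.

Lemma btriZ1 k x y z : btri (k *: x) y z = k *: btri x y z.
Proof. by have := btri_linear1 y z k x 0; rewrite btri01 !addr0. Qed.

Lemma btriZ2 k x y z : btri x (k *: y) z = k *: btri x y z.
Proof. by have := btri_linear2 x z k y 0; rewrite btri02 !addr0. Qed.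

Lemma btriZ3 k x y z : btri x y (k *: z) = k *: btri x y z.
Proof. by have := btri_linear3 x y k z 0; rewrite btri03 !addr0. Qed.

Lemma bmulNl x y : bmul (- x) y = - bmul x y.
Proof. by rewrite -scaleN1r bmulZl scaleN1r. Qed.

Lemma bmulNr x y : bmul x (- y) = - bmul x y.
Proof. by rewrite -scaleN1r bmulZr scaleN1r. Qed.

Lemma btriN1 x y z : btri (- x) y z = - btri x y z.
Proof. by rewrite -scaleN1r btriZ1 scaleN1r. Qed.

Lemma btriN2 x y z : btri x (- y) z = - btri x y z.
Proof. by rewrite -scaleN1r btriZ2 scaleN1r. Qed.

Lemma btriN3 x y z : btri x y (- z) = - btri x y z.
Proof. by rewrite -scaleN1r btriZ3 scaleN1r. Qed.

Definition bol_linE :=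
  (bmulDl, bmulDr, bmulNl, bmulNr, bmulZl, bmulZr,
   (btriD1, btriD2, btriD3, btriN1, btriN2, btriN3, btriZ1, btriZ2, btriZ3)).

End Multilinearity.

Section Bracket.
Variables (K : fieldType) (B : bolSuperalgebra K).
Implicit Types (r s i j : 'Z_2) (P Q R : 'End(B)) (a b c x y : B).

(** The contribution of the product a c to the companion of a bracket: both
sides change by the factor - (-1)^(rs) when (a, r) and (c, s) are exchanged, as
[P,R] does for P and R. *)
Lemma tri_companion_product r s i j a c x y :
    a \in hpart B r -> c \in hpart B s -> x \in hpart B i -> y \in hpart B j ->
  zsign ((r + s) * (i + j)) *: btri x y (bmul a c)
    + bmul (bmul a c) (bmul x y)
  = zsign (s * (i + j)) *: (bmul a (btri x y c) + btri a (bmul x y) c)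
    - zsign (r * s) *: (zsign (r * (i + j)) *:
        (bmul c (btri x y a) + btri c (bmul x y) a)).
Proof.
move=> ar cs xi yj.
have xyij := bmul_hpart xi yj.
have xya := btri_hpart xi yj ar.
have triac : btri a c (bmul x y) =
    - (zsign (r * (s + (i + j))) *: btri c (bmul x y) a
       + zsign ((i + j) * (r + s)) *: btri (bmul x y) a c).
  by apply/eqP; rewrite -addr_eq0 addrA; apply/eqP; apply: bol_BS3.
rewrite (bol_BS5 xi yj ar cs) triac (bol_BS2 xyij ar cs) (bol_BS1 xya cs).
rewrite (bol_BS1 xyij (bmul_hpart ar cs)) !(mulrDl, mulrDr).
(* Each product of two parities must occur in one order only, so that its sign
   is a single unknown. *)
rewrite (mulrC i r) (mulrC i s) (mulrC j r) (mulrC j s).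
sign_module.
Qed.

Lemma has_degreeP r P i x : has_degree r P -> x \in hpart B i ->
  P x \in hpart B (i + r).
Proof. by move=> degP xi; apply: subvP (degP i) _ (memv_img P xi). Qed.

Lemma pseudo_superder_lincomb r P Q a b k :
    pseudo_superder_with r P a -> pseudo_superder_with r Q b ->
  pseudo_superder_with r (P + k *: Q) (a + k *: b).
Proof.
move=> [degP ar Ptri Pmul] [degQ br Qtri Qmul]; split.
- move=> i; apply/subvP => _ /memv_imgP[x xi ->].
  by rewrite !lfunE /= lfunE /= memvD ?memvZ ?has_degreeP.
- by rewrite memvD ?memvZ.
- move=> i j l x y z xi yj zl.
  rewrite !lfunE /= !lfunE /= (Ptri _ _ _ _ _ _ xi yj zl).
  rewrite (Qtri _ _ _ _ _ _ xi yj zl) !bol_linE.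
  sign_module.
- move=> i j x y xi yj.
  rewrite !lfunE /= !lfunE /= (Pmul _ _ _ _ xi yj).
  rewrite (Qmul _ _ _ _ xi yj) !bol_linE.
  sign_module.
Qed.

Lemma pseudo_superder_supercomm r s P R a c :
    pseudo_superder_with r P a -> pseudo_superder_with s R c ->
  pseudo_superder_with (r + s) (supercomm r s P R)
    (P c - zsign (r * s) *: R a - bmul a c).
Proof.
move=> [degP ar Ptri Pmul] [degR cs Rtri Rmul].
have commE x : supercomm r s P R x = P (R x) - zsign (r * s) *: R (P x).
  by rewrite add_lfunE opp_lfunE scale_lfunE !comp_lfunE.
split.
- move=> i; apply/subvP => _ /memv_imgP[x xi ->].
  rewrite commE addrA memvB //; last by rewrite memvZ // !has_degreeP.
  by rewrite addrAC !has_degreeP.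
- have Pc : P c \in hpart B (r + s) by rewrite addrC has_degreeP.
  by rewrite !memvB // ?memvZ ?bmul_hpart ?has_degreeP.
- move=> i j l x y z xi yj zl.
  have Px := has_degreeP degP xi; have Py := has_degreeP degP yj.
  have Pz := has_degreeP degP zl; have Rx := has_degreeP degR xi.
  have Ry := has_degreeP degR yj; have Rz := has_degreeP degR zl.
  rewrite !commE (Ptri _ _ _ _ _ _ xi yj zl) (Rtri _ _ _ _ _ _ xi yj zl).
  rewrite !linearD !linearZ /=.
  rewrite (Ptri _ _ _ _ _ _ Rx yj zl) (Ptri _ _ _ _ _ _ xi Ry zl).
  rewrite (Ptri _ _ _ _ _ _ xi yj Rz) (Rtri _ _ _ _ _ _ Px yj zl).
  rewrite (Rtri _ _ _ _ _ _ xi Py zl) (Rtri _ _ _ _ _ _ xi yj Pz) !bol_linE.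
  rewrite !mulrDr (mulrC s r).
  sign_module.
- move=> i j x y xi yj.
  have Px := has_degreeP degP xi; have Py := has_degreeP degP yj.
  have Rx := has_degreeP degR xi; have Ry := has_degreeP degR yj.
  have xyij := bmul_hpart xi yj.
  (* Solved for (ac)(xy), the product that the companion - a c contributes. *)
  have ac_xy := canRL (addKr _) (tri_companion_product ar cs xi yj).
  rewrite !commE (Pmul _ _ _ _ xi yj) (Rmul _ _ _ _ xi yj).
  rewrite !linearD !linearZ /=.
  rewrite (Pmul _ _ _ _ Rx yj) (Pmul _ _ _ _ xi Ry) (Pmul _ _ _ _ cs xyij).
  rewrite (Rmul _ _ _ _ Px yj) (Rmul _ _ _ _ xi Py) (Rmul _ _ _ _ ar xyij).
  rewrite (Ptri _ _ _ _ _ _ xi yj cs) (Rtri _ _ _ _ _ _ xi yj ar).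
  rewrite (Pmul _ _ _ _ xi yj) (Rmul _ _ _ _ xi yj).
  rewrite !bol_linE ac_xy !mulrDr (mulrC s r).
  sign_module.
Qed.

End Bracket.

Theorem lemma3p3 (K : fieldType) (charK : [pchar K] =i pred0)
    (B : bolSuperalgebra K) (r s : 'Z_2)
    (P Q R : 'End(B)) (a b c : B) (lambda : K)
    (hPa : PS r (P, a)) (hQb : PS r (Q, b)) (hRc : PS s (R, c)) :
  PS r (P + lambda *: Q, a + lambda *: b) /\
  PS (r + s) (supercomm r s P R,
              P c - zsign (r * s) *: R a - bmul a c).
Proof.
have PSI t S d : pseudo_superder_with t S d -> @PS K B t (S, d).
  by move=> Sd; split; first by exists d.
case: hPa hQb hRc => _ Pa [_ Qb] [_ Rc].
split; apply: PSI; first exact: pseudo_superder_lincomb.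
exact: pseudo_superder_supercomm.
Qed.
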